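(* Let $\mu$ be a non-atomic Borel probability measure on $[0,1]$. Let $\lambda_{D,1}<\lambda_{D,2}<\lambda_{D,3}<\cdots$ be the Dirichlet eigenvalues of $-\frac{d}{d\mu}\frac{d}{dx}$. Then the $\lambda_{D,m}$, $m\in\mathbb{N}$, are precisely the squares of the positive zeros of the function $$\sin_\mu^D(z):=\sum_{n=0}^\infty(-1)^n\,q_{2n+1}\,z^{2n+1},\qquad z\in\mathbb{R},$$ where $q_n:=q_n(1)$. The corresponding eigenfunctions $f_{D,m}$ are given by $$f_{D,m}(x)=s_{\lambda,\mu}\bigl(\sqrt{\lambda_{D,m}},x\bigr)=\sqrt{\lambda_{D,m}}\sum_{n=0}^\infty(-1)^n\,\lambda_{D,m}^n\,q_{2n+1}(x),\qquad x\in[0,1],$$ that is, $f_{D,m}$ is an eigenfunction for the eigenvalue $\lambda_{D,m}$.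
   Context: Derivatives with respect to a measure: for a non-atomic Borel probability measure $\nu$ on $[0,1]$ and $f\colon[0,1]\to\mathbb{R}$, a function $h\in L_2([0,1],\nu)$ is the $\nu$-derivative of $f$, written $\frac{df}{d\nu}$, if $f(x)=f(0)+\int_0^x h\,d\nu$ for all $x\in[0,1]$ (it is unique in $L_2(\nu)$). $H^1(\nu)$ is the space of functions possessing a $\nu$-derivative; such functions are continuous. For the Lebesgue measure the derivative is written $f'$ or $\frac{df}{dx}$. $H^2(\lambda,\mu)$, where $\lambda$ as an index denotes Lebesgue measure on $[0,1]$, is the space of all $f$ possessing a Lebesgue derivative $f'$ (that is, $f'$ is square-integrable with respect to Lebesgue measure and $f(x)=f(0)+\int_0^x f'(t)\,dt$ for all $x\in[0,1]$) that belongs to $H^1(\mu)$ (so $f'$ is taken to be the continuous representative). For $f\in H^2(\lambda,\mu)$ put $\Delta_\mu f=\frac{d}{d\mu}f'$. A Dirichlet eigenvalue is a real number $\Lambda$ such that there is a non-zero $f\in H^2(\lambda,\mu)$ (eigenfunction) with $\frac{d}{d\mu}f'=-\Lambda f$ and $f(0)=f(1)=0$. It is well known that the Dirichlet eigenvalues form a strictly increasing sequence $0<\lambda_{D,1}<\lambda_{D,2}<\cdots$ tending to infinity. Eigenfunctions are only determined up to a multiplicative constant. Functions $q_n$: $q_0(x)=1$ and, for $n\in\mathbb{N}=\{1,2,\dots\}$ and $x\in[0,1]$, $q_n(x)=\int_0^x q_{n-1}(t)\,dt$ if $n$ is odd, $q_n(x)=\int_0^x q_{n-1}(t)\,d\mu(t)$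 if $n$ is even. For $z\in\mathbb{R}$, $x\in[0,1]$: $s_{\lambda,\mu}(z,x)=\sum_{n=0}^\infty(-1)^n z^{2n+1}q_{2n+1}(x)$. (All series converge absolutely.) *)

(* Defs.v *)
From HB Require Import structures.
From mathcomp Require Import all_boot all_order all_algebra.
From mathcomp Require Import all_classical all_reals all_analysis.
Set Implicit Arguments.
Unset Strict Implicit.
Unset Printing Implicit Defensive.
Import Order.TTheory GRing.Theory Num.Theory.
Import numFieldNormedType.Exports.
Local Open Scope classical_set_scope.
Local Open Scope ring_scope.

(** Functions and measures on [0,1] are represented by functions and Borel
    measures on the whole line; only the values of the functions on [0,1], and
    only the restrictions of the measures to [0,1], are ever used. *)

Section derivatives.
Context {R : realType}.
Implicit Types (nu : {measure set (measurableTypeR R) -> \bar R}).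
Implicit Types (f g h : R -> R).

Definition L2_unit nu h : Prop :=
  measurable_fun (`[0, 1] : set (measurableTypeR R)) h /\
  nu.-integrable `[0, 1] (fun x => (h x ^+ 2)%:E).

(** [h] represents the class df/dnu in L_2([0,1], nu). *)
Definition is_nu_derivative nu f h : Prop :=
  L2_unit nu h /\
  forall x, x \in `[0, 1] -> f x = f 0 + \int[nu]_(t in `[0, x]) h t.

Definition H1 nu f : Prop := exists h, is_nu_derivative nu f h.

Definition H2 mu f : Prop :=
  exists g, is_nu_derivative lebesgue_measure f g /\ H1 mu g.

(** [h] represents the class (d/dmu) f' in L_2([0,1], mu). The equation defining
    the mu-derivative holds at every point of [0,1], so it forces [g] to be
    the continuous representative of f' when mu has no atoms. *)
Definition is_Delta mu f h : Prop :=
  exists g, is_nu_derivative lebesgue_measure f g /\ is_nu_derivative mu g h.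

(** The eigenvalue equation is an equality in L_2([0,1], mu), that is, it holds
    mu-almost everywhere. *)
Definition dirichlet_eigenfunction mu (Lam : R) f : Prop :=
  [/\ H2 mu f,
      exists h, is_Delta mu f h /\
        {ae mu, forall x, x \in `[0, 1] -> h x = - Lam * f x},
      exists x, x \in `[0, 1] /\ f x <> 0,
      f 0 = 0
    & f 1 = 0].

Definition dirichlet_eigenvalue mu (Lam : R) : Prop :=
  exists f, dirichlet_eigenfunction mu Lam f.

(** Indices are shifted: [lam m] is the (m+1)-st Dirichlet eigenvalue. *)
Definition enumerates_dirichlet_eigenvalues mu (lam : nat -> R) : Prop :=
  increasing_seq lam /\
  forall Lam, dirichlet_eigenvalue mu Lam <-> exists m, Lam = lam m.

End derivatives.

Section sine.
Context {R : realType}.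
Variable mu : {measure set (measurableTypeR R) -> \bar R}.

Fixpoint q (n : nat) : R -> R :=
  match n with
  | 0%N => fun=> 1
  | n'.+1 => fun x =>
      if odd n'.+1 then \int[lebesgue_measure]_(t in `[0, x]) q n' t
      else \int[mu]_(t in `[0, x]) q n' t
  end.

Definition s_lambda_mu (z x : R) : R :=
  limn (series (fun n => (-1) ^+ n * z ^+ n.*2.+1 * q n.*2.+1 x)).

Definition sin_D (z : R) : R :=
  limn (series (fun n => (-1) ^+ n * q n.*2.+1 1 * z ^+ n.*2.+1)).

End sine.

(* Main.v *)
Require Import Defs.
From HB Require Import structures.
From mathcomp Require Import all_boot all_order all_algebra.
From mathcomp Require Import all_classical all_reals all_analysis.
From mathcomp Require Import measurable_realfun ring lra.
Import Order.TTheory GRing.Theory Num.Theory.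
Import numFieldNormedType.Exports.
Local Open Scope classical_set_scope.
Local Open Scope ring_scope.

(** For every real [L], the series f_L = sum_n (-L)^n q_{2n+1} and
    g_L = sum_n (-L)^n q_{2n} converge uniformly on [0,1], since
    q_{2n}(x) <= x^n / n!. Termwise integration gives f_L(x) = int_0^x g_L dt and
    g_L(x) = 1 - L int_0^x f_L dmu. Iterating this pair of integral equations
    shows that every solution with f(0) = 0 is a multiple of f_L, so [L] is a
    Dirichlet eigenvalue iff f_L(1) = 0. For L <= 0 all terms of the series
    f_L(1) are nonnegative and the first is q_1(1) = 1, hence eigenvalues are
    positive; for L = z^2, sin_D(z) = z f_L(1). *)

(** * Series with a convergent numerical majorant *)

Lemma dominated_cvg_series (R : realType) (u M : nat -> R) :
  (forall n, `|u n| <= M n) -> cvgn (series M) -> cvgn (series u).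
Proof.
move=> uM cM; apply: normed_cvg; apply: series_le_cvg cM => //= n.
by apply: le_trans (uM n); exact: normr_ge0.
Qed.

Lemma norm_series_le (R : realType) (u M : nat -> R) n :
  (forall n, `|u n| <= M n) -> cvgn (series M) ->
  `|series u n| <= limn (series M).
Proof.
move=> uM cM; apply: (@le_trans _ _ (series M n)).
  by apply: le_trans (ler_norm_sum _ _ _) _; exact: ler_sum.
(* The majorant is nonnegative because it bounds absolute values, so its partial sums increase to
   their limit. *)
apply: nondecreasing_cvgn_le => //; apply: nondecreasing_series => k _ _.
by apply: le_trans (uM k).
Qed.

Lemma norm_lim_series_le (R : realType) (u M : nat -> R) :
  (forall n, `|u n| <= M n) -> cvgn (series M) ->
  `|limn (series u)| <= limn (series M).
Proof.
move=> uM cM; have cu := dominated_cvg_series _ _ _ uM cM.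
rewrite -lim_norm//; apply: limr_le; first exact: is_cvg_norm.
by apply: nearW => n; exact: norm_series_le.
Qed.

(** * Integration of bounded functions and of uniformly dominated series over a set of finite
    measure *)

Section bounded_integrals.
Context d (T : measurableType d) (R : realType).
Variables (nu : {measure set T -> \bar R}) (D : set T).
Hypotheses (mD : measurable D) (nuD : (nu D < +oo)%E).

Lemma le_bounded_integrable (f : T -> R) (C : R) : measurable_fun D f ->
  (forall x, D x -> `|f x| <= C) -> nu.-integrable D (EFin \o f).
Proof.
move=> mf fC; apply: measurable_bounded_integrable => //.
exists C; split; first exact: num_real.
by move=> x Cx y Dy; exact: le_trans (fC _ Dy) (ltW Cx).
Qed.

Lemma norm_Rintegral_le (f g : T -> R) : nu.-integrable D (EFin \o f) ->
  nu.-integrable D (EFin \o g) -> (forall x, D x -> `|f x| <= g x) ->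
  `|\int[nu]_(x in D) f x| <= \int[nu]_(x in D) g x.
Proof.
move=> fi gi fg; apply: (le_trans (le_normr_Rintegral mD fi)).
by apply: le_Rintegral => //; exact: integrable_norm.
Qed.

Lemma Rintegral_sum (u : nat -> T -> R) n :
  (forall k, nu.-integrable D (EFin \o u k)) ->
  \int[nu]_(x in D) (\sum_(0 <= k < n) u k x) =
  \sum_(0 <= k < n) \int[nu]_(x in D) u k x.
Proof.
move=> iu; have isum m :
    nu.-integrable D (EFin \o (fun x => \sum_(0 <= k < m) u k x)).
  rewrite (_ : _ \o _ = fun x => (\sum_(0 <= k < m) (EFin \o u k) x)%E).
    exact: integrable_sum.
  by apply/funext => x /=; rewrite sumEFin.
elim: n => [|n IHn].
  rewrite big_geq//; under eq_Rintegral do rewrite big_geq//.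
  by rewrite Rintegral_cst// mul0r.
under eq_Rintegral do rewrite big_nat_recr//=.
by rewrite RintegralD// IHn big_nat_recr.
Qed.

Section dominated_series.
Variables (u : nat -> T -> R) (M : nat -> R).
Hypotheses (mu : forall n, measurable_fun D (u n))
  (uM : forall n x, D x -> `|u n x| <= M n) (cM : cvgn (series M)).

Lemma measurable_dominated_series :
  measurable_fun D (fun x => limn (series (u ^~ x))).
Proof.
apply: (@measurable_fun_cvg _ _ _ D (fun n x => series (u ^~ x) n)).
  by move=> m; exact: measurable_sum.
by move=> x Dx; apply: dominated_cvg_series cM => n; exact: uM.
Qed.

(** Dominated convergence applied to the partial sums: all of them are bounded by the constant
    [limn (series M)], which is integrable because [D] has finite measure. *)
Lemma Rintegral_dominated_series :
  series (fun n => \int[nu]_(x in D) u n x) @ \oo -->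
  \int[nu]_(x in D) limn (series (u ^~ x)).
Proof.
have iu n : nu.-integrable D (EFin \o u n).
  by apply: (@le_bounded_integrable _ (M n)) => // x; exact: uM.
have iM : nu.-integrable D (EFin \o cst (limn (series M))).
  apply: (@le_bounded_integrable _ `|limn (series M)|) => //.
have mS n : measurable_fun D (fun x => (series (u ^~ x) n)%:E).
  by apply/measurable_EFinP; exact: measurable_sum.
have mL : measurable_fun D (fun x => (limn (series (u ^~ x)))%:E).
  by apply/measurable_EFinP; exact: measurable_dominated_series.
have SL : {ae nu, forall x, D x ->
    (series (u ^~ x) n)%:E @[n --> \oo] --> (limn (series (u ^~ x)))%:E}.
  apply: aeW => x Dx; apply: cvg_EFin; first exact: nearW.
  by apply: dominated_cvg_series cM => n; exact: uM.
have SM : {ae nu, forall x n, D x ->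
    (`|(series (u ^~ x) n)%:E| <= (EFin \o cst (limn (series M))) x)%E}.
  apply: aeW => x n Dx; rewrite lee_fin/=.
  by apply: norm_series_le => // k; exact: uM.
have [iL _ /=] := dominated_convergence mD mS mL SL iM SM.
(* The limit of the extended-real integrals is finite, so the convergence passes to real numbers. *)
rewrite -(fineK (integrable_fin_num mD iL)) => /fine_cvg.
rewrite (_ : series _ =
  fine \o (fun n => \int[nu]_(x in D) (series (u ^~ x) n)%:E)%E) //.
apply/funext => n; rewrite /= -[RHS]/(Rintegral _ _ _).
by rewrite /series/= Rintegral_sum.
Qed.

End dominated_series.
End bounded_integrals.

Arguments le_bounded_integrable {d T R nu D}.

(** * The comparison monomials x^n / n! *)

Lemma Rintegral_exp_coeff (R : realType) (x : R) n : 0 <= x ->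
  \int[lebesgue_measure]_(t in `[0, x]) exp_coeff t n = exp_coeff x n.+1.
Proof.
(* The fundamental theorem of calculus is applied on a nondegenerate interval; for x = 0 both sides
   are 0. *)
rewrite le_eqVlt => /predU1P[<-|x0].
  by rewrite set_itv1 Rintegral_set1 /exp_coeff/= expr0n/= mul0r.
rewrite /Rintegral (@continuous_FTC2 _ _ (fun y : R => exp_coeff y n.+1))//=.
- by rewrite /exp_coeff/= expr0n/= mul0r subr0.
- apply: continuous_subspaceT => y; rewrite /exp_coeff/=.
  by apply: cvgM; [exact: exprn_continuous|exact: cvg_cst].
- have c y : (fun t : R => exp_coeff t n.+1) z @[z --> y] --> exp_coeff y n.+1.
    by apply: cvgM; [exact: exprn_continuous|exact: cvg_cst].
  split.
  + by move=> y _; apply: derivableM => //; exact: exprn_derivable.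
  + by apply: cvg_at_right_filter; exact: c.
  + by apply: cvg_at_left_filter; exact: c.
- move=> y _; rewrite derive1Mr//; last exact: exprn_derivable.
  rewrite derive1E exp_derive /exp_coeff/= factS natrM invfM.
  rewrite scaler1 /GRing.scale/=.
  by rewrite mulrACA divff ?mul1r// pnatr_eq0.
Qed.

Lemma exp_coeff_unit_le (R : realType) (x : R) n : 0 <= x <= 1 ->
  exp_coeff x n <= n`!%:R^-1.
Proof.
by move=> /andP[x0 x1]; rewrite /exp_coeff/= ler_piMl// exprn_ile1.
Qed.

(** * Integrals over [0,x] and square-integrable functions for Borel measures *)

Section borel_measures.
Context {R : realType}.
Implicit Types (nu : {measure set (measurableTypeR R) -> \bar R}) (x : R).

Lemma lebesgue_0x_lty x :
  ((@lebesgue_measure R) (`[0%R, x]%classic : set (measurableTypeR R)) < +oo)%E.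
Proof. by apply: compact_finite_measure; exact: segment_compact. Qed.

(** Monotonicity holds on the whole line, since [[0, x]] is empty for x < 0. Integrability on
    [[0, z]] comes from the bound [u z]. *)
Lemma nondecreasing_Rintegral_0x nu (u : R -> R) :
  (forall x, (nu `[0%R, x]%classic < +oo)%E) -> nondecreasing_fun u ->
  (forall x, 0 <= u x) ->
  nondecreasing_fun (fun x => \int[nu]_(t in `[0, x]) u t).
Proof.
move=> nuf ndu u0.
have iu z : nu.-integrable `[0, z]%classic (EFin \o u).
  apply: (le_bounded_integrable _ _ _ (u z)) => //.
    exact: nondecreasing_measurable.
  by move=> y /=; rewrite in_itv/= => /andP[_ yz]; rewrite ger0_norm// ndu.
move=> x y xy; apply: fine_le; [exact: integrable_fin_num..|].
apply: ge0_subset_integral => //.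
- by apply/measurable_EFinP; exact: nondecreasing_measurable.
- by move=> t _; rewrite lee_fin.
- move=> t /=; rewrite !in_itv/= => /andP[-> tx]; exact: le_trans tx xy.
Qed.

(** On a finite measure space L_2 is contained in L_1, here through the majorant |h| <= 1 + h^2. *)
Lemma L2_unit_integrable nu (h : R -> R) : (nu `[0%R, 1%R]%classic < +oo)%E ->
  L2_unit nu h -> nu.-integrable `[0, 1]%classic (EFin \o h).
Proof.
move=> nuf [mh ih2].
have i1 : nu.-integrable `[0, 1]%classic (EFin \o cst (1 : R)).
  apply: (le_bounded_integrable _ _ _ 1) => // x _.
  by rewrite normr1.
have m01 : measurable (`[0, 1]%classic : set (measurableTypeR R)) by [].
apply: le_integrable (integrableD m01 i1 ih2) => //.
  exact/measurable_EFinP.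
move=> x _ /=; rewrite lee_fin [leRHS]ger0_norm ?addr_ge0 ?sqr_ge0//.
rewrite -[h x ^+ 2]real_normK ?num_real//.
(* From (|h| - 1)^2 >= 0 one gets 2|h| <= 1 + h^2. *)
by have := sqr_ge0 (`|h x| - 1); have := normr_ge0 (h x); nra.
Qed.

Lemma bounded_L2_unit nu (h : R -> R) (C : R) :
  (nu `[0%R, 1%R]%classic < +oo)%E ->
  measurable_fun (`[0, 1] : set (measurableTypeR R)) h ->
  (forall x, x \in `[0, 1] -> `|h x| <= C) -> L2_unit nu h.
Proof.
move=> nuf mh hC; split => //.
have mX := measurable_funX 2%N mh.
apply: (le_bounded_integrable _ nuf _ (C ^+ 2) mX) => //.
move=> x x01; have hx := hC x x01.
by rewrite normrX ler_pXn2r ?nnegrE//; apply: le_trans hx.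
Qed.

End borel_measures.

(** * The iterated integrals q_n: monotonicity and factorial bounds *)

Section dirichlet_solution.
Context {R : realType} (mu : probability (measurableTypeR R) R).
Implicit Types (x L : R) (n : nat).

Lemma mu_0x_le1 x : (mu `[0%R, x]%classic <= 1)%E.
Proof. exact: probability_le1. Qed.

Lemma mu_0x_lty x : (mu `[0%R, x]%classic < +oo)%E.
Proof. exact: le_lt_trans (mu_0x_le1 x) (ltry _). Qed.

Lemma q_odd n x : q mu n.*2.+1 x =
  \int[lebesgue_measure]_(t in `[0, x]) q mu n.*2 t.
Proof. by rewrite /= odd_double. Qed.

Lemma q_even n x : q mu n.+1.*2 x = \int[mu]_(t in `[0, x]) q mu n.*2.+1 t.
Proof. by rewrite doubleS /= !odd_double. Qed.

(** Sign and monotonicity are proved together because each induction step needs both. Monotonicity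
    then supplies measurability, and boundedness on [[0, x]], with no appeal to continuity. *)
Lemma q_ge0_nondecreasing n :
  (forall x, 0 <= q mu n x) /\ nondecreasing_fun (q mu n).
Proof.
elim: n => [|n [q0 ndq]]; first by split => // x y.
have [qn|qn] : q mu n.+1 = (fun x => \int[lebesgue_measure]_(t in `[0, x]) q mu n t)
    \/ q mu n.+1 = (fun x => \int[mu]_(t in `[0, x]) q mu n t).
  by rewrite /=; case: (odd n); [right|left].
- rewrite qn; split=> [x|]; first by apply: Rintegral_ge0.
  by apply: nondecreasing_Rintegral_0x => // x; exact: lebesgue_0x_lty.
- rewrite qn; split=> [x|]; first by apply: Rintegral_ge0.
  by apply: nondecreasing_Rintegral_0x => // x; exact: mu_0x_lty.
Qed.

Lemma q_ge0 n x : 0 <= q mu n x. Proof. exact: (q_ge0_nondecreasing n).1. Qed.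

Lemma measurable_q n (D : set (measurableTypeR R)) :
  measurable D -> measurable_fun D (q mu n).
Proof.
by move=> mD; apply: nondecreasing_measurable mD (q_ge0_nondecreasing n).2.
Qed.

Lemma q_integrable (nu : {measure set (measurableTypeR R) -> \bar R}) n x :
  (nu `[0%R, x]%classic < +oo)%E -> nu.-integrable `[0, x]%classic (EFin \o q mu n).
Proof.
move=> nuf; apply: (le_bounded_integrable _ _ _ (q mu n x)) => //.
  exact: measurable_q.
move=> t /=; rewrite in_itv/= => /andP[_ tx].
by rewrite ger0_norm ?q_ge0//; exact: (q_ge0_nondecreasing n).2.
Qed.

Lemma exp_coeff_integrable (nu : {measure set (measurableTypeR R) -> \bar R})
  n x : (nu `[0%R, x]%classic < +oo)%E ->
  nu.-integrable `[0, x]%classic (EFin \o (fun t => exp_coeff t n)).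
Proof.
move=> nuf; apply: (le_bounded_integrable _ _ _ (exp_coeff x n)) => //.
  apply: measurable_funM => //; exact: measurable_funX.
move=> t /=; rewrite in_itv/= => /andP[t0 tx].
rewrite ger0_norm ?exp_coeff_ge0//.
rewrite ler_wpM2r// lerXn2r// nnegrE; exact: le_trans t0 tx.
Qed.

(** A Lebesgue integration raises the degree of the monomial bound by one. An integration against
    [mu] keeps it: the integrand is at most its value at the right endpoint, and [[0, x]] has mass
    at most 1. *)
Lemma q_le n x : 0 <= x ->
  q mu n.*2 x <= exp_coeff x n /\ q mu n.*2.+1 x <= exp_coeff x n.+1.
Proof.
(* The odd bound is derived from the even bound of the same index, so that it serves both inside the
   induction and after it. *)
have odd_le m (z : R) : (forall x, 0 <= x -> q mu m.*2 x <= exp_coeff x m) ->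
    0 <= z -> q mu m.*2.+1 z <= exp_coeff z m.+1.
  move=> IH z0; rewrite q_odd -Rintegral_exp_coeff//.
  apply: le_Rintegral => //.
  - by apply: q_integrable; exact: lebesgue_0x_lty.
  - by apply: exp_coeff_integrable; exact: lebesgue_0x_lty.
  - by move=> t /=; rewrite in_itv/= => /andP[t0 _]; exact: IH.
suff even_le m (z : R) : 0 <= z -> q mu m.*2 z <= exp_coeff z m.
  by move=> x0; split; [exact: even_le|apply: odd_le => // z; exact: even_le].
elim: m z => [|m IHm] z z0.
  by rewrite /exp_coeff/= expr0 fact0 divr1.
rewrite q_even.
apply: (@le_trans _ _ (exp_coeff z m.+1 * fine (mu `[0, z]%classic))).
  rewrite -Rintegral_cst//; apply: le_Rintegral => //.
  - by apply: q_integrable; exact: mu_0x_lty.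
  - apply: (le_bounded_integrable _ _ _ `|exp_coeff z m.+1|) => //.
    exact: mu_0x_lty.
  - move=> t /=; rewrite in_itv/= => /andP[t0 tz].
    apply: (le_trans _ (odd_le _ _ IHm z0)).
    by apply: (q_ge0_nondecreasing m.*2.+1).2; exact: tz.
rewrite ler_piMr ?exp_coeff_ge0//.
by rewrite -[leRHS]/(fine 1%E) fine_le ?mu_0x_le1// ge0_fin_numE// mu_0x_lty.
Qed.

(** With [z ^+ 2 = L], [s_lambda_mu mu z] is [z * sol L] on [0,1]; dividing by
    [z] keeps the series meaningful for [L <= 0]. [der L] is the
    Lebesgue derivative of [sol L]. *)
Definition sol_term L n x := (- L) ^+ n * q mu n.*2.+1 x.
Definition der_term L n x := (- L) ^+ n * q mu n.*2 x.
Definition sol L x := limn (series (sol_term L ^~ x)).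
Definition der L x := limn (series (der_term L ^~ x)).

(** * Uniform bounds and measurability of the two series on [0,1] *)

Lemma sol_term_le L n x : x \in `[0, 1] ->
  `|sol_term L n x| <= exp_coeff `|L| n.
Proof.
rewrite in_itv/= => /[dup] x01 /andP[x0 _].
rewrite normrM normrX normrN ler_wpM2l// ger0_norm ?q_ge0//.
apply: (le_trans (q_le n _ x0).2); apply: (le_trans (exp_coeff_unit_le _ _ _ x01)).
(* The sharper 1/(n+1)! is weakened to 1/n!, so that both series share the exponential series of |L|
   as majorant. *)
by rewrite lef_pV2 ?posrE ?ltr0n ?fact_gt0// ler_nat factS leq_pmull.
Qed.

Lemma der_term_le L n x : x \in `[0, 1] ->
  `|der_term L n x| <= exp_coeff `|L| n.
Proof.
rewrite in_itv/= => /[dup] x01 /andP[x0 _].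
rewrite normrM normrX normrN ler_wpM2l// ger0_norm ?q_ge0//.
by apply: (le_trans (q_le n _ x0).1); exact: exp_coeff_unit_le.
Qed.

Lemma is_cvg_sol_term L x : x \in `[0, 1] -> cvgn (series (sol_term L ^~ x)).
Proof.
move=> x01; apply: dominated_cvg_series (is_cvg_series_exp_coeff `|L|) => n.
exact: sol_term_le.
Qed.

Lemma sol_le L x : x \in `[0, 1] -> `|sol L x| <= expR `|L|.
Proof.
move=> x01; apply: norm_lim_series_le (is_cvg_series_exp_coeff `|L|) => n.
exact: sol_term_le.
Qed.

Lemma der_le L x : x \in `[0, 1] -> `|der L x| <= expR `|L|.
Proof.
move=> x01; apply: norm_lim_series_le (is_cvg_series_exp_coeff `|L|) => n.
exact: der_term_le.
Qed.

Lemma subset_0x x : x \in `[0, 1] -> `[0, x] `<=` `[0, 1].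
Proof.
rewrite in_itv/= => /andP[_ x1] t /=; rewrite !in_itv/= => /andP[-> tx].
exact: le_trans tx x1.
Qed.

Lemma measurable_sol_term L n (D : set (measurableTypeR R)) :
  measurable D -> measurable_fun D (sol_term L n).
Proof. by move=> mD; apply: measurable_funM => //; exact: measurable_q. Qed.

Lemma measurable_der_term L n (D : set (measurableTypeR R)) :
  measurable D -> measurable_fun D (der_term L n).
Proof. by move=> mD; apply: measurable_funM => //; exact: measurable_q. Qed.

Lemma measurable_sol L :
  measurable_fun (`[0, 1] : set (measurableTypeR R)) (sol L).
Proof.
apply: measurable_dominated_series (is_cvg_series_exp_coeff `|L|) => //.
- by move=> n; exact: measurable_sol_term.
- by move=> n x; exact: sol_term_le.
Qed.

Lemma measurable_der L :
  measurable_fun (`[0, 1] : set (measurableTypeR R)) (der L).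
Proof.
apply: measurable_dominated_series (is_cvg_series_exp_coeff `|L|) => //.
- by move=> n; exact: measurable_der_term.
- by move=> n x; exact: der_term_le.
Qed.

(** * The coupled integral equations for [sol] and [der] *)

Lemma solE L x : x \in `[0, 1] ->
  sol L x = \int[lebesgue_measure]_(t in `[0, x]) der L t.
Proof.
move=> x01; apply/cvg_lim => //.
have := @Rintegral_dominated_series _ _ _ lebesgue_measure `[0%R, x] _
  (lebesgue_0x_lty x) (der_term L) _ _ _ (is_cvg_series_exp_coeff `|L|).
(* Both sides are brought to the same form: each odd q is unfolded as an integral, and the constant
   (-L)^n is pulled out of the integrated terms. *)
rewrite /sol_term; under [X in _ -> series X @ _ --> _]eq_fun do rewrite q_odd.
under [X in (_ -> _ -> _ -> series X @ _ --> _) -> _]eq_fun => n.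
  rewrite RintegralZl//; last by apply: q_integrable; exact: lebesgue_0x_lty.
  over.
apply=> // [n|n t /(subset_0x _ x01)]; [exact: measurable_der_term|].
exact: der_term_le.
Qed.

Lemma derE L x : x \in `[0, 1] ->
  der L x = 1 - L * \int[mu]_(t in `[0, x]) sol L t.
Proof.
(* Shifting the partial sums by one lets the term q_0 = 1 be split off; every later term contains a
   factor -L and an integral against [mu]. *)
move=> x01; apply/cvg_lim => //; rewrite -cvg_shiftS/=.
have := @Rintegral_dominated_series _ _ _ mu `[0%R, x] _
  (mu_0x_lty x) (sol_term L) _ _ _ (is_cvg_series_exp_coeff `|L|).
under [X in (_ -> _ -> _ -> series X @ _ --> _) -> _]eq_fun => n.
  rewrite RintegralZl//; last by apply: q_integrable; exact: mu_0x_lty.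
  rewrite -q_even.
  over.
move=> h; rewrite (_ : (fun _ => _) = fun n => 1 - L *
    series (fun n => (- L) ^+ n * q mu n.+1.*2 x) n).
  apply: cvgB; first exact: cvg_cst.
  apply: cvgM; [exact: cvg_cst|apply: h => // [n|n t /(subset_0x _ x01)]].
    exact: measurable_sol_term.
  exact: sol_term_le.
apply/funext => n; rewrite /series/= big_nat_recl// {1}/der_term expr0 mul1r.
rewrite -mulNr mulr_sumr; congr +%R; apply: eq_bigr => i _.
by rewrite /der_term exprS mulrA.
Qed.


(** * Uniqueness: every eigenfunction is a multiple of [sol] *)

Lemma mem_0_01 : (0 : R) \in `[0, 1]. Proof. by rewrite in_itv/= lexx ler01. Qed.

Lemma mem_1_01 : (1 : R) \in `[0, 1]. Proof. by rewrite in_itv/= lexx ler01. Qed.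

Lemma sol_integrable L x : x \in `[0, 1] ->
  mu.-integrable `[0, x]%classic (EFin \o sol L).
Proof.
move=> x01; apply: (le_bounded_integrable _ _ _ (expR `|L|)) => //.
- exact: mu_0x_lty.
- exact: measurable_funS (subset_0x _ x01) (measurable_sol L).
- by move=> t /(subset_0x _ x01); exact: sol_le.
Qed.

Lemma der_integrable L x : x \in `[0, 1] ->
  lebesgue_measure.-integrable `[0, x]%classic (EFin \o der L).
Proof.
move=> x01; apply: (le_bounded_integrable _ _ _ (expR `|L|)) => //.
- exact: lebesgue_0x_lty.
- exact: measurable_funS (subset_0x _ x01) (measurable_der L).
- by move=> t /(subset_0x _ x01); exact: der_le.
Qed.

(** Each integration [dx] raises the degree of the monomial bound
    [`|D x| <= C * `|L| ^+ n * x ^+ n / n`!] by one, and each integration [dmu]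
    preserves it because [mu] has mass at most 1. *)
Lemma homogeneous_uniqueness L (D E : R -> R) (C : R) :
  measurable_fun (`[0, 1] : set (measurableTypeR R)) D ->
  measurable_fun (`[0, 1] : set (measurableTypeR R)) E ->
  (forall x, x \in `[0, 1] -> `|D x| <= C) ->
  (forall x, x \in `[0, 1] ->
    D x = \int[lebesgue_measure]_(t in `[0, x]) E t) ->
  (forall x, x \in `[0, 1] -> E x = - L * \int[mu]_(t in `[0, x]) D t) ->
  forall x, x \in `[0, 1] -> D x = 0.
Proof.
move=> mD mE DC DE ED.
have C0 : 0 <= C by apply: le_trans (DC _ mem_0_01).
have EC n : (forall x, x \in `[0, 1] -> `|D x| <= C * `|L| ^+ n * exp_coeff x n) ->
    forall x, x \in `[0, 1] -> `|E x| <= C * `|L| ^+ n.+1 * exp_coeff x n.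
  move=> IH x x01; have x0 : 0 <= x by move: x01; rewrite in_itv/= => /andP[].
  rewrite ED// normrM normrN.
  rewrite [leRHS](_ : _ = `|L| * (C * `|L| ^+ n * exp_coeff x n)); last first.
    by rewrite exprS; ring.
  rewrite ler_wpM2l//.
  set B := C * _ * _.
  have B0 : 0 <= B by rewrite !mulr_ge0 ?exprn_ge0 ?exp_coeff_ge0.
  apply: (@le_trans _ _ (B * fine (mu `[0, x]%classic))).
    rewrite -Rintegral_cst//; apply: norm_Rintegral_le => //.
    - apply: (le_bounded_integrable _ _ _ C) => //.
      + exact: mu_0x_lty.
      + exact: measurable_funS (subset_0x _ x01) mD.
      + by move=> t /(subset_0x _ x01); exact: DC.
    - apply: (le_bounded_integrable _ _ _ `|B|) => //.
      exact: mu_0x_lty.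
    - move=> t /[dup] /(subset_0x _ x01) t01 /=; rewrite in_itv/= => /andP[t0 tx].
      apply: (le_trans (IH _ t01)); rewrite ler_wpM2l ?mulr_ge0 ?exprn_ge0//.
      by rewrite ler_wpM2r// lerXn2r// nnegrE.
  rewrite ler_piMr// -[leRHS]/(fine 1%E) fine_le ?mu_0x_le1//.
  by rewrite ge0_fin_numE// mu_0x_lty.
have DC' n x : x \in `[0, 1] -> `|D x| <= C * `|L| ^+ n * exp_coeff x n.
  elim: n x => [|n IHn] x x01.
    by rewrite expr0 /exp_coeff/= expr0 fact0 divr1 !mulr1 DC.
  have x0 : 0 <= x by move: x01; rewrite in_itv/= => /andP[].
  rewrite DE// -Rintegral_exp_coeff// -RintegralZl//; last first.
    by apply: exp_coeff_integrable; exact: lebesgue_0x_lty.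
  apply: norm_Rintegral_le => //.
  (* Integrability of [E] needs only the degree-0 case of the bound, |E| <= C |L|. *)
  - apply: (le_bounded_integrable _ _ _ (C * `|L|)) => //.
    + exact: lebesgue_0x_lty.
    + exact: measurable_funS (subset_0x _ x01) mE.
    + move=> t /(subset_0x _ x01) t01; apply: (le_trans (EC 0%N _ _ t01)).
        by move=> y y01; rewrite expr0 /exp_coeff/= expr0 fact0 divr1 !mulr1 DC.
      by rewrite expr1 /exp_coeff/= expr0 fact0 divr1 mulr1.
  - rewrite (_ : _ \o _ = fun t => ((C * `|L| ^+ n.+1)%:E *
      (EFin \o (fun t => exp_coeff t n)) t)%E)//.
    apply: integrableZl => //.
    by apply: exp_coeff_integrable; exact: lebesgue_0x_lty.
  - by move=> t /(subset_0x _ x01); exact: EC.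
move=> x x01; apply/eqP; rewrite -normr_eq0 eq_le normr_ge0 andbT.
(* The bound is C (|L| x)^n / n!, which tends to 0 as n grows. *)
have : C * exp_coeff (`|L| * x) n @[n --> \oo] --> C * 0.
  by apply: cvgM; [exact: cvg_cst|exact: cvg_exp_coeff].
rewrite mulr0 => c; rewrite -(cvg_lim _ c)//; apply: limr_ge.
  by apply/cvg_ex; exists 0.
apply: nearW => n; rewrite /exp_coeff/= exprMn 2!mulrA -mulrA.
exact: DC'.
Qed.

(** The constant is c = f'(0), that is [g 0]. The differences f - c [sol L] and f' - c [der L]
    satisfy the homogeneous integral equations, so the first one vanishes. *)
Lemma dirichlet_eigenfunction_sol L f : dirichlet_eigenfunction mu L f ->
  exists c, forall x, x \in `[0, 1] -> f x = c * sol L x.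
Proof.
move=> [_ [h [[g [[L2g fE] [[mh _] gE]] hf]] _ f0 _]].
have ig : lebesgue_measure.-integrable `[0, 1]%classic (EFin \o g).
  by apply: L2_unit_integrable L2g; exact: lebesgue_0x_lty.
have mg := L2g.1.
have fE' x : x \in `[0, 1] -> f x = \int[lebesgue_measure]_(t in `[0, x]) g t.
  by move=> x01; rewrite fE// f0 add0r.
have mf : measurable_fun (`[0, 1] : set (measurableTypeR R)) f.
  apply: (eq_measurable_fun
    (fun x => \int[lebesgue_measure]_(t in `[0, x]) g t)).
    by move=> x; rewrite inE => x01; rewrite fE'.
  (* As an indefinite Lebesgue integral, f is continuous on [0,1]. This makes it measurable for [mu]
     as well. *)
  apply: subspace_continuous_measurable_fun => //.
  exact: parameterized_integral_continuous.
(* The L_1 norm of f' bounds f, because f(0) = 0. *)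
pose Cf := \int[lebesgue_measure]_(t in `[0, 1]) `|g t|.
have fC x : x \in `[0, 1] -> `|f x| <= Cf.
  move=> x01; rewrite fE'//.
  have sub := subset_0x _ x01.
  have igx : lebesgue_measure.-integrable `[0, x]%classic (EFin \o g).
    by apply: integrableS ig.
  apply: (le_trans (le_normr_Rintegral _ igx)) => //.
  apply: fine_le; [by apply: integrable_fin_num => //; exact: integrable_norm..|].
  apply: ge0_subset_integral => //.
  by apply/measurable_EFinP; exact: measurableT_comp.
have ifx x : x \in `[0, 1] -> mu.-integrable `[0, x]%classic (EFin \o f).
  move=> x01; apply: (le_bounded_integrable _ _ _ Cf) => //.
  - exact: mu_0x_lty.
  - exact: measurable_funS (subset_0x _ x01) mf.
  - by move=> t /(subset_0x _ x01); exact: fC.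
have gE' x : x \in `[0, 1] -> g x = g 0 - L * \int[mu]_(t in `[0, x]) f t.
  move=> x01; rewrite gE// -mulNr -RintegralZl//; last exact: ifx.
  (* The eigenvalue equation holds only [mu]-almost everywhere, which suffices under the
     integral. *)
  congr (_ + fine _); apply: ae_eq_integral => //.
  - by apply/measurable_EFinP; exact: measurable_funS (subset_0x _ x01) mh.
  - apply/measurable_EFinP; apply: measurable_funM => //.
    exact: measurable_funS (subset_0x _ x01) mf.
  - have aeF := ae_filter_ringOfSetsType mu.
    by apply: filterS hf => t ht /(subset_0x _ x01) t01; rewrite ht.
exists (g 0) => x x01; apply/eqP; rewrite -subr_eq0; apply/eqP.
pose D y := f y - g 0 * sol L y; pose E y := g y - g 0 * der L y.
apply: (homogeneous_uniqueness L D E (Cf + `|g 0| * expR `|L|)) => //.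
- by apply: measurable_funB => //; apply: measurable_funM => //;
    exact: measurable_sol.
- by apply: measurable_funB => //; apply: measurable_funM => //;
    exact: measurable_der.
- move=> y y01; apply: (le_trans (ler_normB _ _)); apply: lerD; first exact: fC.
  by rewrite normrM ler_wpM2l// sol_le.
- move=> y y01; have iy : lebesgue_measure.-integrable `[0, y]%classic (EFin \o g).
    by apply: integrableS ig => //; exact: subset_0x.
  rewrite /D /E fE'// solE// -RintegralZl//; last exact: der_integrable.
  rewrite RintegralB//.
  exact: integrableZl (der_integrable L y y01).
- move=> y y01; rewrite /D /E gE'// derE//.
  rewrite RintegralB//; [|exact: ifx|]; last first.
    exact: integrableZl (sol_integrable L y y01).
  rewrite RintegralZl//; last exact: sol_integrable.
  ring.
Qed.

(** * Boundary values and non-vanishing of [sol] *)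

Lemma Rintegral_1_0x (x : R) : 0 <= x ->
  \int[lebesgue_measure]_(t in `[0, x]) 1 = x :> R.
Proof.
move=> x0; rewrite -[RHS]divr1 -[X in X / _]expr1 -[RHS]/(exp_coeff x 1).
rewrite -Rintegral_exp_coeff//; apply: eq_Rintegral => t _.
by rewrite /exp_coeff/= expr0 fact0 divr1.
Qed.

Lemma sol0 L : sol L 0 = 0.
Proof. by rewrite solE ?mem_0_01// set_itv1 Rintegral_set1. Qed.

Lemma sol_ge1 L : L <= 0 -> 1 <= sol L 1.
Proof.
move=> L0; apply: limr_ge; first exact: is_cvg_sol_term mem_1_01.
(* The partial sum must contain its first term q_1(1) = 1; the remaining terms are nonnegative. *)
near=> n; have n0 : (0 < n)%N by near: n; exists 1%N.
rewrite -(prednK n0) /series/= big_nat_recl//= {1}/sol_term expr0 mul1r.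
rewrite q_odd/= Rintegral_1_0x// lerDl sumr_ge0// => i _.
by rewrite mulr_ge0 ?q_ge0// exprn_ge0// oppr_ge0.
Unshelve. all: by end_near. Qed.

(** If [sol L] vanished on [0,1], its integral equation would force [der L] to be constantly 1,
    hence [sol L 1] = 1. *)
Lemma sol_neq0 L : exists x, x \in `[0, 1] /\ sol L x <> 0.
Proof.
apply/not_existsP => nsol.
have sol_0 x : x \in `[0, 1] -> sol L x = 0.
  by move=> x01; apply: contrapT => /(conj x01); exact: nsol.
have der_1 x : x \in `[0, 1] -> der L x = 1.
  move=> x01; rewrite derE//.
  rewrite (@eq_Rintegral _ _ _ _ _ (cst 0)) ?Rintegral_cst ?mul0r ?mulr0 ?subr0//.
  by move=> t; rewrite inE => /(subset_0x _ x01); exact: sol_0.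
have := sol_0 1 mem_1_01; rewrite solE ?mem_1_01//.
rewrite (@eq_Rintegral _ _ _ _ _ (cst 1)) ?Rintegral_1_0x//; first exact/eqP/oner_neq0.
by move=> t; rewrite inE; exact: der_1.
Qed.

(** * Comparison with the sine series *)

(** One factor z comes out of z^(2k+1) = z (z^2)^k. Assuming z^2 = L lets the identity apply both to
    an arbitrary zero z of [sin_D] and to the square root of an eigenvalue. *)
Lemma s_lambda_muE L z x : z ^+ 2 = L -> x \in `[0, 1] ->
  s_lambda_mu mu z x = z * sol L x.
Proof.
move=> zL x01; apply/cvg_lim => //.
have cz : z * series (sol_term L ^~ x) n @[n --> \oo] --> z * sol L x.
  by apply: cvgM; [exact: cvg_cst|exact: is_cvg_sol_term].
rewrite (_ : series _ = fun n => z * series (sol_term L ^~ x) n)//.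
apply/funext => n; rewrite /series/= mulr_sumr; apply: eq_bigr => k _.
have zk : z ^+ k.*2.+1 = z * (z ^+ 2) ^+ k by rewrite exprS -mul2n exprM.
by rewrite /sol_term -zL [(- z ^+ 2) ^+ k]exprNn zk [in LHS]mulrCA !mulrA.
Qed.

Lemma sin_DE L z : z ^+ 2 = L -> sin_D mu z = z * sol L 1.
Proof.
move=> zL; rewrite -(s_lambda_muE _ _ _ zL mem_1_01).
by congr (limn (series _)); apply/funext => n; rewrite mulrAC.
Qed.

Lemma der0 L : der L 0 = 1.
Proof.
rewrite derE ?mem_0_01// (@eq_Rintegral _ _ _ _ _ (cst 0)).
  by rewrite Rintegral_cst// mul0r mulr0 subr0.
by move=> t; rewrite set_itv1 inE => ->; rewrite sol0.
Qed.

(** * Characterization of Dirichlet eigenvalues and eigenfunctions *)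

(** The factor z and the agreement on [0,1] alone let this cover both [sol L] itself, with z = 1,
    and [s_lambda_mu], with z the square root of L. *)
Lemma sol_eigenfunction L z f : z != 0 -> sol L 1 = 0 ->
  (forall x, x \in `[0, 1] -> f x = z * sol L x) ->
  dirichlet_eigenfunction mu L f.
Proof.
move=> z0 sol1 fE.
have dfg : is_nu_derivative lebesgue_measure f (fun x => z * der L x).
  split.
    apply: (bounded_L2_unit _ _ (`|z| * expR `|L|)).
    - exact: lebesgue_0x_lty.
    - by apply: measurable_funM => //; exact: measurable_der.
    - by move=> x x01; rewrite normrM ler_wpM2l// der_le.
  move=> x x01; rewrite !fE ?mem_0_01// sol0 mulr0 add0r solE//.
  by rewrite RintegralZl//; exact: der_integrable.
have dgh : is_nu_derivative mu (fun x => z * der L x)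
    (fun x => - L * z * sol L x).
  split.
    apply: (bounded_L2_unit _ _ (`|L| * `|z| * expR `|L|)).
    - exact: mu_0x_lty.
    - by apply: measurable_funM => //; exact: measurable_sol.
    - by move=> x x01; rewrite !normrM normrN ler_wpM2l ?mulr_ge0// sol_le.
  move=> x x01; rewrite der0 derE//.
  rewrite RintegralZl//; last exact: sol_integrable.
  ring.
split; [by exists (fun x => z * der L x); split => //; eexists; exact: dgh| | |
  by rewrite fE ?mem_0_01// sol0 mulr0|by rewrite fE ?mem_1_01// sol1 mulr0].
- eexists; split; first by exists (fun x => z * der L x); split; [exact: dfg|exact: dgh].
  by apply: aeW => x x01; rewrite fE// mulrA.
- have [x [x01 /eqP solx]] := sol_neq0 L; exists x; split => //.
  by rewrite fE//; apply/eqP; rewrite mulf_neq0.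
Qed.

Lemma dirichlet_eigenvalueP L : dirichlet_eigenvalue mu L <-> sol L 1 = 0.
Proof.
split=> [[f fL]|sol1]; last first.
  exists (fun x => 1 * sol L x).
  by apply: (@sol_eigenfunction _ 1) => //; exact: oner_neq0.
have [c fE] := dirichlet_eigenfunction_sol _ _ fL.
case: fL => _ _ [x [x01 fx]] _ f1.
have := fE 1 mem_1_01; rewrite f1 => /esym/eqP; rewrite mulf_eq0.
(* The multiple c cannot be 0, since an eigenfunction is non-zero somewhere; hence [sol L 1] = 0. *)
by case/orP => /eqP // c0; exfalso; apply: fx; rewrite fE// c0 mul0r.
Qed.

Lemma dirichlet_eigenvalue_gt0 L : dirichlet_eigenvalue mu L -> 0 < L.
Proof.
move=> /dirichlet_eigenvalueP sol1; rewrite ltNge; apply/negP => /sol_ge1.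
by rewrite sol1 ler10.
Qed.

Lemma dirichlet_eigenvalue_sin_D L : dirichlet_eigenvalue mu L <->
  exists z : R, [/\ 0 < z, sin_D mu z = 0 & L = z ^+ 2].
Proof.
split=> [eL|[z [z0 sz Lz]]].
  have L0 := dirichlet_eigenvalue_gt0 _ eL.
  exists (Num.sqrt L); split; [by rewrite sqrtr_gt0| |by rewrite sqr_sqrtr ?ltW].
  rewrite (sin_DE L) ?sqr_sqrtr ?ltW//.
  by have /dirichlet_eigenvalueP -> := eL; rewrite mulr0.
apply/dirichlet_eigenvalueP/eqP; move/eqP: sz.
(* Since z > 0, the factor z in [sin_D mu z] = z [sol L 1] can be cancelled. *)
by rewrite (sin_DE L)// mulf_eq0 gt_eqF.
Qed.

Lemma s_lambda_mu_eigenfunction L : dirichlet_eigenvalue mu L ->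
  dirichlet_eigenfunction mu L (s_lambda_mu mu (Num.sqrt L)) /\
  forall x : R, x \in `[0, 1] -> s_lambda_mu mu (Num.sqrt L) x =
    Num.sqrt L * limn (series (fun n => (-1) ^+ n * L ^+ n * q mu n.*2.+1 x)).
Proof.
move=> eL; have L0 := dirichlet_eigenvalue_gt0 _ eL.
have sE x : x \in `[0, 1] ->
    s_lambda_mu mu (Num.sqrt L) x = Num.sqrt L * sol L x.
  by apply: s_lambda_muE; rewrite sqr_sqrtr ?ltW.
split.
  apply: (sol_eigenfunction _ (Num.sqrt L)) => //.
    by rewrite gt_eqF// sqrtr_gt0.
  exact/dirichlet_eigenvalueP.
move=> x x01; rewrite sE//; congr (_ * _); congr (limn (series _)).
by apply/funext => n; rewrite /sol_term [(- L) ^+ n]exprNn.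
Qed.

End dirichlet_solution.

Theorem proposition3p8 (R : realType)
    (mu : probability (measurableTypeR R) R)
    (mu_unit : mu [set` `[0 : R, 1]] = 1%E)
    (mu_nonatomic : forall x : R, mu [set x] = 0%E) :
  [/\ forall Lam : R, dirichlet_eigenvalue mu Lam <->
        exists z : R, [/\ 0 < z, sin_D mu z = 0 & Lam = z ^+ 2],
      forall Lam : R, dirichlet_eigenvalue mu Lam ->
        dirichlet_eigenfunction mu Lam (s_lambda_mu mu (Num.sqrt Lam)) /\
        forall x : R, x \in `[0, 1] ->
          s_lambda_mu mu (Num.sqrt Lam) x =
          Num.sqrt Lam *
            limn (series (fun n => (-1) ^+ n * Lam ^+ n * q mu n.*2.+1 x))
    & forall lam : nat -> R, enumerates_dirichlet_eigenvalues mu lam ->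
        [set lam m | m in [set: nat]] =
          [set z ^+ 2 | z in [set z : R | 0 < z /\ sin_D mu z = 0]] /\
        forall m : nat,
          dirichlet_eigenfunction mu (lam m)
            (s_lambda_mu mu (Num.sqrt (lam m))) /\
          forall x : R, x \in `[0, 1] ->
            s_lambda_mu mu (Num.sqrt (lam m)) x =
            Num.sqrt (lam m) *
              limn (series (fun n =>
                (-1) ^+ n * lam m ^+ n * q mu n.*2.+1 x))].
Proof.
split=> [L|L|lam [_ lamE]].
- exact: dirichlet_eigenvalue_sin_D.
- exact: s_lambda_mu_eigenfunction.
(* The range of an enumeration is exactly the set of eigenvalues, so both claims reduce to the two
   preceding clauses. *)
split=> [|m]; last by apply: s_lambda_mu_eigenfunction => //; apply/lamE; exists m.
apply/seteqP; split=> L /=.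
- move=> [m _ lamL].
  have /dirichlet_eigenvalue_sin_D [z [z0 sz Lz]] :
    dirichlet_eigenvalue mu L by apply/lamE; exists m.
  by exists z.
- move=> [z [z0 sz] zL].
  have /lamE[m Lm] : dirichlet_eigenvalue mu L.
    by apply/dirichlet_eigenvalue_sin_D; exists z.
  by exists m.
Qed.
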